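(* Let $Z$ be a nonempty compact metric space. Then there exists a dynamical system $(X,T)$ which is transitive compact but not totally transitive, such that the set $M$ of all minimal points of $(X,T)$ is homeomorphic to $Z$, every minimal point of $(X,T)$ is a fixed point, and $M=\omega_{\mathcal{N}_T}(x)$ for some $x\in X$.
   Context: A dynamical system $(X,T)$: $X$ is a compact metric space with more than one point and without isolated points, $T:X\to X$ a continuous surjection. A point is minimal if it lies in a minimal subset, i.e. a nonempty closed set $K$ with $TK=K$ containing no nonempty closed proper subset $K'$ with $TK'\subset K'$. ''Opene'' means open and nonempty. $N_T(U,V)=\{n\in\mathbb{Z}_+:U\cap T^{-n}V\neq\varnothing\}$. $(X,T)$ is transitive if $N_T(U,V)\neq\varnothing$ for all opene $U,V$; totally transitive if $(X,T^k)$ is transitive for all $k\in\mathbb{N}$. $\mathcal{N}_T$ is the family of all subsets of $\mathbb{Z}_+$ containing some $N_T(U,V)$ with $U,V$ opene; $\omega_{\mathcal{N}_T}(x)=\bigcap_{F\in\mathcal{N}_T}\overline{\{T^ix:i\in F\}}$; $(X,T)$ is transitive compact if $\omega_{\mathcal{N}_T}(x)\neq\varnothing$ for all $x$. *)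

(* Defs.v *)
From HB Require Import structures.
From mathcomp Require Import all_boot all_order all_algebra.
From mathcomp Require Import all_classical all_reals all_analysis.
Set Implicit Arguments. Unset Strict Implicit. Unset Printing Implicit Defensive.
Import Order.TTheory GRing.Theory Num.Theory.
Local Open Scope classical_set_scope.

Section dyn.
Context {X : topologicalType}.
Implicit Types (T : X -> X) (U V A K : set X).

Definition opene U := open U /\ U !=set0.

Definition NT T U V : set nat := [set n | U `&` (iter n T @^-1` V) !=set0].

Definition dtransitive T := forall U V, opene U -> opene V -> NT T U V !=set0.

Definition totally_transitive T := forall k : nat, (0 < k)%N -> dtransitive (iter k T).

Definition NT_family T : set (set nat) :=
  [set F | exists U V, [/\ opene U, opene V & NT T U V `<=` F]].

Definition omega_NT T (x : X) : set X :=
  \bigcap_(F in NT_family T) closure [set iter i T x | i in F].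

Definition transitive_compact T := forall x : X, omega_NT T x !=set0.

Definition minimal_subset T K :=
  [/\ K !=set0, closed K, T @` K = K &
      ~ exists K', [/\ K' !=set0, closed K', K' `<` K & T @` K' `<=` K']].

Definition minimal_point T (x : X) := exists K, minimal_subset T K /\ K x.

Definition dynamical_system T :=
  [/\ compact [set: X], (exists x y : X, x <> y),
      (forall x : X, ~ open [set x]), continuous T & (forall y : X, exists x : X, T x = y)].
End dyn.

(* Main.v *)
Require Import Defs.
From HB Require Import structures.
From mathcomp Require Import all_boot all_order all_algebra.
From mathcomp Require Import all_classical all_reals all_analysis.
From mathcomp Require Import zify lra.
Set Implicit Arguments. Unset Strict Implicit. Unset Printing Implicit Defensive.
Import Order.TTheory GRing.Theory Num.Theory.
Local Open Scope classical_set_scope.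

(** The system is the shift on sequences of pairs (value in Z, mark) in which
    the value may change only right after a mark, all marked positions have the
    same parity, and any window of length L contains at most sqrt L marks.

    Sparsity produces arbitrarily long unmarked, hence constant, stretches, so
    every orbit accumulates at a constant unmarked sequence: these are exactly
    the minimal points and form a copy of Z. Two finite patterns can be spliced
    over any large enough gap of the right parity, so N(U, V) contains all large
    integers of one parity class. Marks at even and at odd positions never
    communicate under the square of the shift, which is thus not transitive.
    Accordingly a point of omega_N(x) is a limit of both the even and the odd
    part of the orbit of x; it cannot carry a mark, so it is constant.
    Conversely a fixed point which is a limit of the orbit of x lies in
    omega_N(x). A point with marks at the powers of 4 and values running
    through a dense sequence of Z realises omega_N(x) = M. *)

(** * Sparse sets of natural numbers: gaps, splicing, lacunary sets *)

Section sparse_sets.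
Local Open Scope nat_scope.
Implicit Types (b c : nat -> bool) (i j k l m n L : nat).

Definition cnt b i L := \sum_(j < L) b (i + j).

(** Bounding every window makes the condition shift invariant, and each instance reads finitely many
    positions, so it passes to limits. *)
Definition sparse b := forall i L, cnt b i L ^ 2 <= L.

Lemma cnt0 b i : cnt b i 0 = 0.
Proof. by rewrite /cnt big_ord0. Qed.

Lemma cntS b i L : cnt b i L.+1 = cnt b i L + b (i + L).
Proof. by rewrite /cnt big_ord_recr. Qed.

Lemma cntD b i L L' : cnt b i (L + L') = cnt b i L + cnt b (i + L) L'.
Proof.
elim: L' => [|L' IH]; first by rewrite addn0 cnt0 addn0.
by rewrite addnS !cntS IH addnA addnA.
Qed.

Lemma cnt_le b c i j L :
  (forall k, k < L -> b (i + k) -> c (j + k)) -> cnt b i L <= cnt c j L.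
Proof.
move=> bc; apply: leq_sum => k _.
by case: (b _) (bc k (ltn_ord k)) => // ->.
Qed.

Lemma cnt_eq0 b i L : (forall k, k < L -> ~~ b (i + k)) -> cnt b i L = 0.
Proof. by move=> b0; apply: big1 => k _; rewrite (negbTE (b0 _ _)). Qed.

Lemma cnt_gt0 b i L k : k < L -> b (i + k) -> 0 < cnt b i L.
Proof.
by move=> kL bk; rewrite /cnt (bigD1 (Ordinal kL)) //= bk.
Qed.

Lemma cnt_pred1_le1 q i L : cnt (pred1 q) i L <= 1.
Proof.
suff: cnt (pred1 q) i L <= (q < i + L) by case: (q < _) => //; lia.
elim: L => [|L IH]; first by rewrite cnt0.
rewrite cntS [pred1 _ _]/=; move: IH; case: eqP => e; do 2 case: ltnP => ?; lia.
Qed.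

(** Otherwise [m + 1] consecutive windows of length [m] would hold at least [m + 1] marks within
    length [(m + 1) m < (m + 1) ^ 2]. *)
Lemma sparse_gap b i m : sparse b ->
  exists2 j, i <= j & forall k, k < m -> ~~ b (j + k).
Proof.
move=> sb; apply: contrapT => noj.
have hit j : i <= j -> 0 < cnt b j m.
  move=> ij; rewrite lt0n; apply/eqP => cj; apply: noj; exists j => // k km.
  by apply/negP => bk; have := cnt_gt0 km bk; rewrite cj.
have many k : k <= cnt b i (k * m).
  elim: k => // k IH; rewrite mulSn addnC cntD.
  have := hit (i + k * m) (leq_addr _ _); lia.
have := sb i (m.+1 * m); have := many m.+1.
rewrite -mulnn; nia.
Qed.

Definition splice b c m q n i :=
  if i <= q then (i < m) && b i || (i == q)
  else [&& n <= i, i - n < m & c (i - n)].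

Lemma sparse_splice b c m q n : sparse b -> sparse c ->
  m + (m + m).+1 ^ 2 <= q -> q + (m + m).+1 ^ 2 <= n ->
  sparse (splice b c m q n).
Proof.
move=> sb sc mq qn i L; set w := splice b c m q n.
set g := (m + m).+1 ^ 2 in mq qn.
have g1 : 0 < g by rewrite /g expn_gt0.
(* The three groups of marks are [g] apart, so a shorter window meets only one
   of them, while a longer one tolerates all [2 m + 1] marks. *)
have [gL|Lg] := leqP g L.
  apply: leq_trans gL; rewrite leq_sqr.
  have before k : k <= q -> cnt w 0 k <= minn m k.
    elim: k => [|k IH] kq; first by rewrite cnt0.
    rewrite cntS add0n {2}/w /splice (ltnW kq) (ltn_eqF kq) orbF.
    have := IH (ltnW kq); case: (ltnP k m) => km /=; last lia.
    by case: (b k); lia.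
  have after k : cnt w 0 (q.+1 + k) <= m.+1 + minn m (q.+1 + k - n).
    elim: k => [|k IH].
      rewrite addn0 cntS add0n; have := before q (leqnn q).
      by case: (w q); lia.
    rewrite addnS cntS add0n {2}/w /splice [_ <= q]leqNgt.
    rewrite addSn in IH *; rewrite ltnS leq_addr /=.
    case: (leqP n _) => nk /=; last lia.
    case: (ltnP _ m) => km /=; last lia.
    by case: (c _); lia.
  have [iLq|qiL] := leqP (i + L) q.
    have := before _ iLq; rewrite cntD add0n; lia.
  have := after (i + L - q.+1); rewrite subnKC // cntD add0n; lia.
have [iLq|qiL] := leqP (i + L) q.
  apply: leq_trans (sb i L); rewrite leq_sqr; apply: cnt_le => k kL.
  rewrite /w /splice; case: ifP => [_ /orP[/andP[]//|]|]; lia.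
(* Here [q < i + L] and [L < g] give [m < i], so before [n] only [q] can be marked. *)
have [iLn|niL] := leqP (i + L) n.
  have : cnt w i L <= 1.
    apply: leq_trans (cnt_pred1_le1 q i L); apply: cnt_le => k kL.
    rewrite /w /splice /=; case: ifP => _ ; last lia.
    by case/orP => //; lia.
  case: L => [|L] in Lg qiL iLn *; first by rewrite cnt0.
  by case: (cnt _ _ _) => [|[|]].
(* From here on [n < i + L] and [L < g] give [q < i]: only the copy of [c] is met. *)
have wc k : q < k -> w k -> (n <= k) && c (k - n).
  by move=> qk; rewrite /w /splice leqNgt qk /= => /and3P[-> _ ->].
have [ni|i_n] := leqP n i.
  apply: leq_trans (sc (i - n) L); rewrite leq_sqr; apply: cnt_le => k kL wk.
  have /andP[_] := wc (i + k) ltac:(lia) wk.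
  by rewrite addnBAC.
(* The window straddles [n]: its first [n - i] positions are unmarked and the rest is an initial
   window of [c]. *)
rewrite -(subnKC (_ : n - i <= L)); last lia.
rewrite cntD (cnt_eq0 (i := i)); last first.
  by move=> k ki; apply/negP => /wc; lia.
rewrite add0n subnKC; last lia.
apply: (@leq_trans (L - (n - i))); last lia.
apply: leq_trans (sc 0 _); rewrite leq_sqr; apply: cnt_le => k kL wk.
have /andP[_] := wc (n + k) ltac:(lia) wk.
by rewrite addKn.
Qed.

(** Induction on [L], strengthened: a window with [c > 0] marks contains a mark [l >= 4 ^ c], since
    each mark is at least 4 times the previous one. *)
Lemma sparse_lacunary b : (forall l, b l -> 4 <= l) ->
  (forall l k, b l -> b k -> l < k -> 4 * l <= k) -> sparse b.
Proof.
move=> b4 blac i L.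
suff [] : cnt b i L ^ 2 <= L /\
    (0 < cnt b i L -> exists l, [/\ i <= l, l < i + L, b l & 4 ^ cnt b i L <= l]).
  by [].
elim: L => [|L [IH1 IH2]]; first by rewrite cnt0.
rewrite cntS; case: (boolP (b _)) => [biL|_]; last first.
  rewrite addn0; split; first exact: leqW.
  by case/IH2 => l [? ? ? ?]; exists l; split=> //; lia.
rewrite addn1; have [c0|c_gt0] := posnP (cnt b i L).
  rewrite c0; split=> // _; exists (i + L); split=> //; try lia.
  exact: b4.
have [l [il lL bl cl]] := IH2 c_gt0.
have lp := blac _ _ bl biL lL.
split; last by move=> _; exists (i + L); split=> //; rewrite ?expnS; lia.
(* Since [i <= l] and [4 l <= i + L], one has [L >= 3 l], which is at least three times
   [4 ^ cnt b i L]. *)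
have : (cnt b i L).+1 ^ 2 <= 4 ^ cnt b i L + 1 + 2 * 4 ^ cnt b i L.
  elim: (cnt b i L) => // k; rewrite -!mulnn (expnS 4).
  have : k < 4 ^ k by exact: ltn_expl.
  move: (4 ^ k); nia.
lia.
Qed.

(* [1 < i] discards [4 ^ 0], the only odd power. *)
Definition lacunary_marks i := (1 < i) && (i == 4 ^ trunc_log 4 i).

Lemma lacunary_marksP i : reflect (exists k, i = 4 ^ k.+1) (lacunary_marks i).
Proof.
apply: (iffP idP) => [/andP[i1 /eqP ei]|[k ->]].
  case: (trunc_log 4 i) ei => [|k] ei; first by rewrite ei in i1.
  by exists k.
rewrite /lacunary_marks trunc_expnK // eqxx andbT.
by apply: leq_trans (ltn_expl k.+1 (isT : 1 < 4)); lia.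
Qed.

Lemma sparse_lacunary_marks : sparse lacunary_marks.
Proof.
apply: sparse_lacunary => [l /lacunary_marksP[k ->]|].
  by rewrite expnS -{1}[4]muln1 leq_mul2l expn_gt0.
move=> l k /lacunary_marksP[a ->] /lacunary_marksP[c ->].
by rewrite ltn_exp2l // => ac; rewrite -expnS leq_exp2l.
Qed.

Lemma lacunary_marks_even i : lacunary_marks i -> odd i = false.
Proof. by case/lacunary_marksP => k ->; rewrite expnS oddM. Qed.

(** The base 4 logarithm jumps only at powers of 4; at the excluded power 1 there is no jump, as
    [trunc_log 4 0] is 0 too. *)
Lemma trunc_log_lacunary i :
  ~~ lacunary_marks i -> trunc_log 4 i = trunc_log 4 i.-1.
Proof.
case: i => // -[|i] // ni; apply/esym.
have /= := trunc_log_bounds (isT : 1 < 4) (isT : 0 < i.+2).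
move: ni; rewrite /lacunary_marks /= => ni ib.
by apply: trunc_log_eq => //; move: ni ib; case: eqP => //= ne _; lia.
Qed.

Lemma lacunary_gap k j : 0 < j -> j < 4 ^ k ->
  ~~ lacunary_marks (4 ^ k + j) /\ trunc_log 4 (4 ^ k + j).-1 = k.
Proof.
move=> j0 jk; rewrite /lacunary_marks.
have lg i : i < 4 ^ k -> trunc_log 4 (4 ^ k + i) = k.
  by move=> ik; apply: trunc_log_eq => //; rewrite expnS; lia.
split; first by rewrite lg //; lia.
by rewrite -(prednK j0) addnS /= lg //; lia.
Qed.
End sparse_sets.

(** * The space of marked sequences and its metric *)

Definition admissible (Z : Type) (x : nat -> Z * bool) :=
  [/\ forall i j, (x i).2 -> (x j).2 -> odd i = odd j,
      sparse (fun i => (x i).2) &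
      forall i, ~~ (x i).2 -> (x i.+1).1 = (x i).1].

Definition marked (R : realType) (Z : metricType R) : Type :=
  {x : nat -> Z * bool | admissible x}.

Section marked_metric.
Local Open Scope ring_scope.
Context {R : realType} {Z : metricType R}.
Implicit Types x y w : marked Z.

Definition mark x i : bool := (sval x i).2.
Definition val_at x i : Z := (sval x i).1.

Lemma marked_eq x y :
  (forall i, mark x i = mark y i) -> (forall i, val_at x i = val_at y i) ->
  x = y.
Proof.
case: x y => [x ax] [y ay]; rewrite /mark /val_at /= => xy2 xy1.
have exy : x = y.
  apply/funext => i; rewrite [x i]surjective_pairing [y i]surjective_pairing.
  by rewrite xy1 xy2.
by case: y / exy in ay xy1 xy2 *; congr exist; exact: Prop_irrelevance.
Qed.

Lemma mark_parity x i j : mark x i -> mark x j -> odd i = odd j.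
Proof. by have [+ _ _] := proj2_sig x; apply. Qed.

Lemma mark_sparse x : sparse (mark x).
Proof. by have [_ + _] := proj2_sig x. Qed.

Lemma val_atS x i : ~~ mark x i -> val_at x i.+1 = val_at x i.
Proof. by have [_ _ +] := proj2_sig x; apply. Qed.

(** Truncation at 1 and the weights tending to 0 make the supremum over [i] a metric for the product
    topology, with marks discrete. *)
Definition coord_dist x y i : R :=
  (if mark x i == mark y i then Num.min 1 (mdist (val_at x i) (val_at y i))
   else 1) / i.+1%:R.

Definition marked_dist x y : R := sup (range (coord_dist x y)).

Lemma coord_dist_le1 x y i : coord_dist x y i <= i.+1%:R^-1.
Proof.
rewrite -[leRHS]mul1r ler_pM2r ?invr_gt0 //.
by case: ifP => // _; rewrite ge_min lexx.
Qed.

Lemma coord_dist_ge0 x y i : 0 <= coord_dist x y i.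
Proof.
rewrite divr_ge0 //; case: ifP => // _.
by rewrite le_min ler01 mdist_ge0.
Qed.

Lemma coord_dist_le x y i : coord_dist x y i <= marked_dist x y.
Proof.
apply: ub_le_sup; last by exists i.
exists 1 => _ [j _ <-]; apply: le_trans (coord_dist_le1 _ _ _) _.
by rewrite invf_le1 // ler1n.
Qed.

Lemma marked_dist_le x y e :
  (forall i, coord_dist x y i <= e) -> marked_dist x y <= e.
Proof.
by move=> xye; apply: ge_sup; [exists (coord_dist x y 0), 0%N|move=> _ [i _ <-]].
Qed.

Lemma marked_distxx x : marked_dist x x = 0.
Proof.
apply/eqP; rewrite eq_le (le_trans _ (coord_dist_le x x 0)) ?coord_dist_ge0 //.
rewrite andbT; apply: marked_dist_le => i.
by rewrite /coord_dist eqxx mdistxx min_r ?mul0r.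
Qed.

Lemma marked_dist_eq0 x y : marked_dist x y = 0 -> x = y.
Proof.
move=> xy0.
have c0 i : coord_dist x y i = 0.
  by apply/eqP; rewrite eq_le coord_dist_ge0 andbT -xy0 coord_dist_le.
have {c0} c0 i : mark x i = mark y i /\ val_at x i = val_at y i.
  have /eqP := c0 i; rewrite /coord_dist mulf_eq0 invr_eq0 pnatr_eq0 orbF.
  case: (mark x i =P mark y i) => [-> |_]; last by rewrite oner_eq0.
  move=> /eqP m0; split=> //; apply: mdist_positivity.
  by move: m0; case: (leP 1 (mdist (val_at x i) (val_at y i))) => // _ /eqP;
    rewrite oner_eq0.
by apply: marked_eq => i; case: (c0 i).
Qed.

Lemma marked_dist_sym x y : marked_dist x y = marked_dist y x.
Proof.
congr sup; apply: eq_imagel => i _.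
by rewrite /coord_dist eq_sym metric_sym.
Qed.

Lemma marked_dist_triangle y x w :
  marked_dist x w <= marked_dist x y + marked_dist y w.
Proof.
apply: marked_dist_le => i.
apply: (@le_trans _ _ (coord_dist x y i + coord_dist y w i)); last first.
  by apply: lerD; exact: coord_dist_le.
rewrite /coord_dist -mulrDl ler_pM2r ?invr_gt0 //.
have := metric_triangle (val_at x i) (val_at y i) (val_at w i).
have := mdist_ge0 (val_at x i) (val_at y i).
have := mdist_ge0 (val_at y i) (val_at w i).
move: (mdist _ _) (mdist _ _) (mdist _ _) => d1 d2 d3 ? ? ?.
case: (mark x i) (mark y i) (mark w i) => -[] [] /=;
  case: (leP 1 d1) => ?; case: (leP 1 d2) => ?; case: (leP 1 d3) => ?; lra.
Qed.

HB.instance Definition _ := gen_eqMixin (marked Z).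
HB.instance Definition _ := gen_choiceMixin (marked Z).
HB.instance Definition _ := @isMetric.Build R (marked Z)
  marked_dist marked_distxx marked_dist_eq0 marked_dist_sym marked_dist_triangle.

Definition cylinder x n (e : R) : set (marked Z) :=
  [set y | forall i, (i < n)%N ->
    mark x i = mark y i /\ mdist (val_at x i) (val_at y i) < e].

Lemma nbhs_cylinder x n e : 0 < e -> nbhs x (cylinder x n e).
Proof.
move=> e0; rewrite -metricType_numDomainType.filter_from_mdist_nbhs /=.
(* Coordinates below [n] have weight above [1 / (n + 1)]; the bound by 1 forces equal marks. *)
exists (Num.min 1 e / n.+1%:R) => [|y /= xy i ilt].
  by rewrite divr_gt0 // lt_min ltr01.
have ci : coord_dist x y i < Num.min 1 e / n.+1%:R.
  exact: le_lt_trans (coord_dist_le x y i) xy.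
have {ci} : coord_dist x y i < Num.min 1 e / i.+1%:R.
  apply: (lt_le_trans ci); rewrite ler_pM2l ?lt_min ?ltr01 //.
  by rewrite lef_pV2 ?posrE // ler_nat ltnW.
rewrite /coord_dist ltr_pM2r ?invr_gt0 //; case: (mark x i =P mark y i) => [->|_].
  case: (leP 1 e) => ?; case: (leP 1 (mdist _ _)) => ? ?; split=> //; lra.
by case: (leP 1 e) => ? ?; lra.
Qed.

Lemma nbhs_cylinderP x (U : set (marked Z)) : nbhs x U ->
  exists n e, 0 < e /\ cylinder x n e `<=` U.
Proof.
rewrite -metricType_numDomainType.filter_from_mdist_nbhs => -[e /= e0 eU].
have e20 : 0 < e / 2 by rewrite divr_gt0.
(* Coordinates from [n] on contribute less than [e / 2]. Halving [e] restores strictness, as a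
   supremum of smaller terms may reach [e / 2]. *)
have [n _ ne] := near_infty_natSinv_lt (PosNum e20).
exists n, (e / 2); split=> // y xy; apply: eU => /=.
apply: (@le_lt_trans _ _ (e / 2)); last by lra.
apply: marked_dist_le => i; have [ilt|ni] := ltnP i n; last first.
  by apply: le_trans (coord_dist_le1 _ _ _) (ltW (ne i ni)).
have [mxy vxy] := xy i ilt; rewrite /coord_dist mxy eqxx.
rewrite ler_pdivrMr //.
have : e / 2 <= e / 2 * i.+1%:R by rewrite ler_pMr // ler1n.
by case: (leP 1 (mdist _ _)) => ? ?; lra.
Qed.

End marked_metric.

(** * Compactness of the space of marked sequences *)

Section marked_compact.
Local Open Scope ring_scope.
Context {R : realType} {Z : metricType R}.
Implicit Types x y w : marked Z.

Let seqs : topologicalType := prod_topology (fun _ : nat => (Z * bool)%type).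

Lemma nbhs_prod_cylinder (p : seqs) n (e : R) : 0 < e ->
  nbhs p [set f : seqs | forall i, (i < n)%N ->
    (f i).2 = (p i).2 /\ mdist (p i).1 (f i).1 < e].
Proof.
move=> e0.
have near_coord i : \forall f \near p,
    (f i).2 = (p i).2 /\ mdist (p i).1 (f i).1 < e.
  apply: (@proj_continuous _ (fun _ : nat => (Z * bool)%type) i p
    [set a | a.2 = (p i).2 /\ mdist (p i).1 a.1 < e]).
  exists (ball (p i).1 e, [set (p i).2]) => /=.
    by split; [exact: nbhsx_ballx|].
  by move=> [a b] /= []; rewrite ballEmdist.
have : nbhs p [set f : seqs | forall i : 'I_n,
    (f (val i)).2 = (p (val i)).2 /\ mdist (p (val i)).1 (f (val i)).1 < e].
  pose P (i : 'I_n) (f : seqs) :=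
    (f (val i)).2 = (p (val i)).2 /\ mdist (p (val i)).1 (f (val i)).1 < e.
  exact: (@filter_forall seqs 'I_n P (nbhs p) _ (fun i => near_coord (val i))).
by apply: filterS => f h i ilt; exact: (h (Ordinal ilt)).
Qed.

(** Tychonoff gives a cluster point [p] in the full product. Each admissibility condition involves
    finitely many coordinates and is closed, so [p] inherits it. *)
Lemma marked_compact : compact [set: Z] -> compact [set: marked Z].
Proof.
move=> cZ F FF _.
have cA : compact [set: (Z * bool)%type].
  rewrite -setXTT; apply: compact_setX => //; apply: finite_compact.
  exact: finite_finset.
have := @tychonoff _ (fun _ : nat => (Z * bool)%type) (fun=> setT) (fun=> cA).
move=> /(_ ((fun x : marked Z => sval x : seqs) @ F)).
have -> : [set f : seqs | forall i : nat, [set: (Z * bool)%type] (f i)] = setT.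
  by apply/seteqP; split.
move=> /(_ _ filterT)[p [_ clp]].
have approx A n (e : R) : F A -> 0 < e -> exists2 x, A x &
    forall i, (i < n)%N -> mark x i = (p i).2 /\ mdist (p i).1 (val_at x i) < e.
  move=> FA e0.
  have FA' : ((fun x : marked Z => sval x : seqs) @ F) (sval @` A).
    by apply: (@filterS _ F _ A) => // x Ax; exists x.
  have [_ [[x Ax <-] xp]] := clp _ _ FA' (nbhs_prod_cylinder p n e0).
  by exists x.
have adp : admissible p.
  split.
  - move=> i j pi pj; have [x _ xp] := approx _ (maxn i j).+1 1 filterT ltr01.
    have [xi _] := xp i ltac:(lia); have [xj _] := xp j ltac:(lia).
    by apply: (@mark_parity _ _ x); rewrite ?xi ?xj.
  - move=> i L; have [x _ xp] := approx _ (i + L)%N 1 filterT ltr01.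
    apply: leq_trans (mark_sparse x i L); rewrite leq_sqr.
    by apply: cnt_le => k kL; have [-> _] := xp (i + k)%N ltac:(lia).
  - move=> i npi; apply: mdist_positivity.
    apply/eqP; rewrite eq_le mdist_ge0 andbT; apply/ler_addgt0Pl => e e0.
    have e20 : 0 < e / 2 by rewrite divr_gt0.
    have [x _ xp] := approx _ i.+2 _ filterT e20.
    have [_ x1] := xp i.+1 ltac:(lia); have [xi x0] := xp i ltac:(lia).
    rewrite val_atS ?xi // in x1.
    have := metric_triangle (p i.+1).1 (val_at x i) (p i).1.
    rewrite (metric_sym (val_at x i)); lra.
exists (exist _ (p : nat -> Z * bool) adp : marked Z); split=> // A B FA.
move=> /nbhs_cylinderP[n [e [e0 sB]]].
have [x Ax xp] := approx A n e FA e0.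
exists x; split=> //; apply: sB => i /xp[-> ?].
by [].
Qed.

End marked_compact.

(** * The shift and its hitting times *)

Section mshift.
Context {R : realType} {Z : metricType R}.
Implicit Types x y w : marked Z.

Lemma shift_admissible x : admissible (fun i => sval x i.+1).
Proof.
split=> [i j xi xj|i L|i].
- exact/negb_inj/(mark_parity (xi : mark x i.+1) (xj : mark x j.+1)).
- apply: leq_trans (mark_sparse x i.+1 L); rewrite leq_sqr.
  by apply: cnt_le => k kL; rewrite addSn.
- exact: (@val_atS _ _ x).
Qed.

Definition mshift x : marked Z := exist _ _ (shift_admissible x).

Lemma mark_iter_shift n x i : mark (iter n mshift x) i = mark x (n + i).
Proof. by elim: n i => // n IH i; rewrite addSnnS -IH. Qed.

Lemma val_at_iter_shift n x i : val_at (iter n mshift x) i = val_at x (n + i).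
Proof. by elim: n i => // n IH i; rewrite addSnnS -IH. Qed.

Lemma shift_continuous : continuous (mshift : marked Z -> marked Z).
Proof.
move=> x U /nbhs_cylinderP[n [e [e0 sU]]].
apply: filterS (nbhs_cylinder x n.+1 e0) => y xy; apply: sU => i ilt.
exact: (xy i.+1).
Qed.

Lemma shift_surjective y : exists x, mshift x = y.
Proof.
(* The new entry is unmarked, so it has to carry the first value of [y]. *)
pose x i := if i is j.+1 then sval y j else (val_at y 0, false).
have ax : admissible x.
  split=> [[|i] [|j] //= yi yj|i L|[|i]] //=.
  - by rewrite (mark_parity (yi : mark y i) (yj : mark y j)).
  - case: i => [|i]; last first.
      apply: leq_trans (mark_sparse y i L); rewrite leq_sqr.
      by apply: cnt_le => k kL; rewrite addSn.
    case: L => [|L]; first by rewrite cnt0.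
    rewrite -add1n cntD cntS cnt0 /= !add0n.
    apply: leqW; apply: leq_trans (mark_sparse y 0 L); rewrite leq_sqr.
    exact: cnt_le.
  - exact: (@val_atS _ _ y).
by exists (exist _ x ax); apply: marked_eq.
Qed.

Lemma marked_parity x : exists p, forall i, mark x i -> odd i = p.
Proof.
have [[i xi]|nx] := pselect (exists i, mark x i).
  by exists (odd i) => j xj; exact: mark_parity xj xi.
by exists false => i xi; case: nx; exists i.
Qed.

(* The mark inserted at [q] is what allows the value to jump from [x] to [y]. *)
Lemma splice_point x y m q n p : odd q = p ->
  (m + (m + m).+1 ^ 2 <= q)%N -> (q + (m + m).+1 ^ 2 <= n)%N ->
  (forall i, mark x i -> odd i = p) ->
  (forall i, mark y i -> odd (n + i) = p) ->
  exists w, (forall i, (i < m)%N -> mark w i = mark x i /\ val_at w i = val_at x i) /\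
    (forall i, (i < m)%N ->
      mark w (n + i) = mark y i /\ val_at w (n + i) = val_at y i).
Proof.
move=> oq mq2 qn px py; have mq : (m <= q)%N := leq_trans (leq_addr _ _) mq2.
have g0 : (0 < (m + m).+1 ^ 2)%N by rewrite expn_gt0.
(* Clamping at [m] freezes the value after each pattern; as [i - n] is 0 for [i < n], the value
   right after [q] is already the first one of [y]. *)
pose w i := (if (i <= q)%N then val_at x (minn i m) else val_at y (minn (i - n) m),
  splice (mark x) (mark y) m q n i).
have wp i : (w i).2 -> odd i = p.
  rewrite /w /splice /=; case: (leqP i q) => [iq /orP[/andP[_ /px//]|/eqP->//]|qi].
  by case/and3P => ni _ /py; rewrite subnKC.
have aw : admissible w.
  split=> [i j /wp-> /wp->//|i L|i]; first exact:
    (sparse_splice (mark_sparse x) (mark_sparse y) mq2 qn).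
  rewrite /w /splice /=; case: (ltngtP i q) => iq /=.
  - rewrite orbF; case: (ltnP i m) => im /= xi.
      by rewrite !(minn_idPl _) ?val_atS // ltnW.
    by rewrite !(minn_idPr _) // ltnW.
  - case: (leqP n i) => ni /=; last first.
      move=> _; congr (val_at y (minn _ m)); lia.
    case: (ltnP (i - n) m) => im /= yi.
      by rewrite subSn // !(minn_idPl _) ?val_atS // ltnW.
    by rewrite subSn // !(minn_idPr _) // ltnW.
  - by rewrite orbT.
exists (exist _ w aw); rewrite /mark /val_at /w /splice /=; split=> i im.
  have iq : (i <= q)%N by lia.
  rewrite iq im (minn_idPl (ltnW im)) [i == q]eqn_leq iq /=.
  by rewrite leqNgt (leq_trans im mq) orbF.
have -> : (n + i <= q)%N = false by lia.
by rewrite leq_addr addKn im (minn_idPl (ltnW im)).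
Qed.

(** If the marks of [x] in [U] and [y] in [V] have parities [px] and [py], then moving [y] by [n]
    aligns them when [n] has parity [px (+) py], and splicing applies. *)
Lemma shift_NT U V : opene U -> opene V -> exists K p,
  forall n, (K <= n)%N -> odd n = p -> NT (mshift : marked Z -> marked Z) U V n.
Proof.
move=> [oU [x Ux]] [oV [y Vy]].
have [m1 [e1 [e10 sU]]] := nbhs_cylinderP (open_nbhs_nbhs (conj oU Ux)).
have [m2 [e2 [e20 sV]]] := nbhs_cylinderP (open_nbhs_nbhs (conj oV Vy)).
have [px hx] := marked_parity x; have [py hy] := marked_parity y.
pose m := maxn m1 m2; pose g := ((m + m).+1 ^ 2)%N.
(* Doubling lets [px] set the parity of [q] while keeping [m + g <= q]. *)
pose q := ((m + g).*2 + px)%N.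
exists (q + g)%N, (px (+) py) => n qn on.
have [||i /hy oi|w [wx wy]] := @splice_point x y m q n px _ _ qn hx _.
- by rewrite /q oddD odd_double oddb.
- by rewrite /q /g; lia.
- by rewrite oddD on oi -addbA addbb addbF.
exists w; split.
  apply: sU => i i1; have [-> ->] := wx i ltac:(lia).
  by rewrite mdistxx.
apply: sV => i i2; rewrite mark_iter_shift val_at_iter_shift.
have [-> ->] := wy i ltac:(lia).
by rewrite mdistxx.
Qed.

End mshift.

(* Near the fixed point [w] two consecutive points of the orbit are both close
   to [w], so one of the two times has the required parity. *)
Lemma omega_NT_fixed (X : topologicalType) (T : X -> X) (x w : X) :
  {for w, continuous T} -> T w = w ->
  (forall U V, opene U -> opene V -> exists K p,
    forall n, (K <= n)%N -> odd n = p -> NT T U V n) ->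
  (forall W, nbhs w W -> forall K, exists2 i, (K <= i)%N & W (iter i T x)) ->
  omega_NT T x w.
Proof.
move=> cT Tw NTUV orbW F [U [V [oU oV sF]]] B nB.
have [K [p Kp]] := NTUV U V oU oV.
have nTB : nbhs w (T @^-1` B) by apply: cT; rewrite Tw.
have [i Ki [Bi BTi]] := orbW _ (filterI nB nTB) K.
have [oi|oi] := eqVneq (odd i) p.
  by exists (iter i T x); split=> //; exists i => //; apply/sF/Kp.
exists (iter i.+1 T x); split=> //; exists i.+1 => //; apply/sF/Kp.
  exact: leqW.
by move: oi => /=; case: (odd i) p {Kp} => -[].
Qed.

(** * Finite nets and recurrent dense sequences in compact metric spaces *)

Section compact_metric.
Local Open Scope ring_scope.
Context {R : realType} {Z : metricType R}.

Lemma compact_net (e : R) : compact [set: Z] -> 0 < e ->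
  exists s : seq Z, forall z, exists2 c, c \in s & mdist c z < e.
Proof.
move=> /compact_near_coveringP cZ e0.
(* Finite lists directed by inclusion: locally [z] itself serves as a net point, and near-covering
   compactness yields one list for all of [Z]. *)
pose F : set_system (seq Z) :=
  filter_from setT (fun s0 : seq Z => [set s : seq Z | {subset s0 <= s}]).
have FF : Filter F.
  apply: filter_from_filter; first by exists [::].
  move=> s t _ _; exists (s ++ t) => // u /= su.
  by split=> c cs; apply: su; rewrite mem_cat cs ?orbT.
have [|s0 _ s0P] := cZ _ F (fun s z => exists2 c, c \in s & mdist c z < e) FF.
  move=> z _; exists (ball z e, [set s : seq Z | z \in s]) => /=.
    split; first exact: nbhsx_ballx.
    by exists [:: z] => // s; apply; rewrite mem_head.
  by move=> [y s] /= []; rewrite ballEmdist /= => zy zs; exists z.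
by exists s0 => z; apply: (s0P s0).
Qed.

Lemma compact_dense_seq : compact [set: Z] -> [set: Z] !=set0 ->
  exists u : nat -> Z, forall z (e : R) K, 0 < e ->
    exists2 k, (K <= k)%N & mdist (u k) z < e.
Proof.
move=> cZ [z0 _].
have /choice[net netP] : forall n, exists s : seq Z,
    forall z, exists2 c, c \in s & mdist c z < n.+1%:R^-1.
  by move=> n; apply: compact_net => //; rewrite invr_gt0.
(* The third component is a dummy: it makes every net point occur infinitely often. *)
pose u k := if unpickle k is Some t then
  let: (n, i, _) := t : nat * nat * nat in nth z0 (net n) i else z0.
exists u => z e K e0.
have [n _ /(_ n (leqnn n)) /= ne] := near_infty_natSinv_lt (PosNum e0).
have [c cn cz] := netP n z.
suff [j Kj] : exists j : nat, (K <= pickle (n, index c (net n), j))%N.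
  exists (pickle (n, index c (net n), j)) => //.
  by rewrite /u pickleK nth_index // (lt_trans cz).
apply: contrapT => /forallNP small.
pose f (j : nat) := pickle (n, index c (net n), j).
have fi : injective f by move=> a b /(pcan_inj pickleK) [].
(* Pigeonhole: an injective [f] cannot send [K + 1] numbers below [K]. *)
have : (size (map f (iota 0 K.+1)) <= size (iota 0 K))%N.
  apply: uniq_leq_size; first by rewrite map_inj_uniq // iota_uniq.
  move=> _ /mapP[j _ ->]; rewrite mem_iota add0n leq0n /=.
  by rewrite ltnNge; apply/negP/small.
by rewrite size_map !size_iota ltnn.
Qed.

End compact_metric.

(** * Minimal points, limit sets and the final system *)

Section marked_dynamics.
Context {R : realType} {Z : metricType R}.
Implicit Types (x y w : marked Z) (z : Z).

Lemma const_admissible z : admissible (fun _ : nat => (z, false)).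
Proof. by split=> // i L; rewrite cnt_eq0. Qed.

Definition const_point z : marked Z := exist _ _ (const_admissible z).

Lemma shift_const_point z : mshift (const_point z) = const_point z.
Proof. exact: marked_eq. Qed.

Lemma const_point_continuous : continuous const_point.
Proof.
move=> z U /nbhs_cylinderP[n [e [e0 sU]]].
apply: filterS (nbhsx_ballx z e e0) => y; rewrite ballEmdist => zy.
by apply: sU.
Qed.

Lemma val_at_continuous i : continuous (fun x => val_at x i).
Proof.
move=> x U; rewrite -metricType_numDomainType.filter_from_mdist_nbhs.
move=> [e e0 sU]; apply: filterS (nbhs_cylinder x i.+1 e0) => y xy.
by apply: sU; have [] := xy i (ltnSn i).
Qed.

Lemma val_at_gap x i m : (forall k, (k < m)%N -> ~~ mark x (i + k)) ->
  forall k, (k <= m)%N -> val_at x (i + k) = val_at x i.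
Proof.
move=> gap; elim=> [|k IH] km; first by rewrite addn0.
by rewrite addnS val_atS ?gap // IH // ltnW.
Qed.

Lemma unmarked_const x :
  (forall i, ~~ mark x i) -> x = const_point (val_at x 0).
Proof.
move=> nx; apply: marked_eq => i; first exact/negbTE.
exact: (@val_at_gap x 0 i).
Qed.

Lemma open_mark i : open [set x : marked Z | mark x i].
Proof.
rewrite openE => x xi; apply: filterS (nbhs_cylinder x i.+1 ltr01) => y xy.
by have [+ _] := xy i (ltnSn i); rewrite /= => <-.
Qed.

(** The orbit enters ever longer unmarked gaps, on which the value is constant; these values cluster
    at some [z] by compactness. *)
Lemma orbit_cluster_const x : compact [set: Z] ->
  exists z, forall W, nbhs (const_point z) W ->
    forall K, exists2 i, (K <= i)%N & W (iter i mshift x).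
Proof.
move=> cZ.
have /choice[j jP] : forall n, exists j, (n <= j)%N /\
    forall k, (k < n)%N -> ~~ mark x (j + k).
  by move=> n; have [j nj h] := sparse_gap n n (mark_sparse x); exists j.
have [z [_ clz]] := cZ ((fun n => val_at x (j n)) @ \oo) _ filterT.
exists z => W /nbhs_cylinderP[n [e [e0 sW]]] K.
have inA : \forall k \near \oo, [set val_at x (j k) | k in [set k | (maxn n K <= k)%N]]
    (val_at x (j k)).
  by exists (maxn n K) => // k kn; exists k.
have [_ [[k /= kn <-] zk]] := clz _ _ inA (nbhsx_ballx z e e0).
have [kj gap] := jP k.
exists (j k); first lia.
apply: sW => i ilt; rewrite mark_iter_shift val_at_iter_shift.
rewrite (val_at_gap gap) ?(negbTE (gap _ _)); [|lia..].
by move: zk; rewrite ballEmdist.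
Qed.

Lemma minimal_const z : minimal_point mshift (const_point z).
Proof.
exists [set const_point z]; split=> //; split.
- by exists (const_point z).
- exact/accessible_closed_set1/hausdorff_accessible/metric_hausdorff.
- by rewrite image_set1 shift_const_point.
- move=> [K' [[a Ka] _ [sK nK] _]]; apply: nK => _ ->.
  by rewrite -(sK a Ka).
Qed.

(** A minimal set is closed and contains the orbit of [x], hence a constant point, whose singleton
    must then be the whole set. *)
Lemma minimal_pointP x : compact [set: Z] ->
  minimal_point mshift x <-> exists z, x = const_point z.
Proof.
move=> cZ; split=> [[K [[_ cK TK minK] Kx]]|[z ->]]; last exact: minimal_const.
have [z zP] := orbit_cluster_const x cZ; exists z.
have Kit i : K (iter i mshift x).
  by elim: i => //= i IH; rewrite -TK; exists (iter i mshift x).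
have Kz : K (const_point z).
  apply: cK => B nB; have [i _ Bi] := zP B nB 0%N.
  by exists (iter i mshift x).
apply: contrapT => xz; apply: minK; exists [set const_point z]; split.
- by exists (const_point z).
- exact/accessible_closed_set1/hausdorff_accessible/metric_hausdorff.
- by split=> [_ ->//|/(_ x Kx)].
- by rewrite image_set1 shift_const_point.
Qed.

(** Taking the logarithm of [i.-1] delays the jump to the position right after the mark. *)
Lemma lacunary_admissible (u : nat -> Z) :
  admissible (fun i => (u (trunc_log 4 i.-1), lacunary_marks i)).
Proof.
split=> [i j /lacunary_marks_even -> /lacunary_marks_even ->|i L|i] //=.
  exact: sparse_lacunary_marks.
by move=> /trunc_log_lacunary ->.
Qed.

Definition lacunary_point (u : nat -> Z) : marked Z :=
  exist _ _ (lacunary_admissible u).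

Lemma opene_mark (z : Z) i : (i <= 4)%N -> opene [set x : marked Z | mark x i].
Proof.
move=> i4; split; first exact: open_mark.
(* The first lacunary mark is at 4 and is shifted down to [i]. *)
exists (iter (4 - i) mshift (lacunary_point (fun=> z))) => /=.
by rewrite mark_iter_shift subnK //; apply/lacunary_marksP; exists 0%N.
Qed.

Lemma lacunary_point_orbit (u : nat -> Z) z :
  (forall (e : R) K, (0 < e)%R -> exists2 k, (K <= k)%N & (mdist (u k) z < e)%R) ->
  forall W, nbhs (const_point z) W ->
  forall K, exists2 i, (K <= i)%N & W (iter i mshift (lacunary_point u)).
Proof.
move=> uz W /nbhs_cylinderP[n [e [e0 sW]]] K.
have [k Kk kz] := uz e (maxn n.+1 K) e0.
have k4 : (k < 4 ^ k)%N by exact: ltn_expl.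
(* Right after the mark [4 ^ k] the value is [u k], and the next [n < 4 ^ k] positions are
   unmarked. *)
exists (4 ^ k).+1; first lia.
apply: sW => i ilt; rewrite mark_iter_shift val_at_iter_shift addSnnS.
have [nm lg] := @lacunary_gap k i.+1 isT ltac:(lia).
by rewrite /mark /val_at /= (negbTE nm) lg metric_sym.
Qed.

Lemma mark_NT_parity i j n :
  NT mshift [set x : marked Z | mark x i] [set x : marked Z | mark x j] n ->
  odd i = odd (n + j).
Proof. by move=> [x [/= xi]]; rewrite mark_iter_shift; exact: mark_parity. Qed.

(** A mark of [y] at [i] is an open condition. Testing it along return times from mark 0 to mark 0
    (all even) and to mark 1 (all odd) gives [x] marks of both parities. *)
Lemma omega_NT_const x y : omega_NT mshift x y -> exists z, y = const_point z.
Proof.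
move=> xy; exists (val_at y 0); apply: unmarked_const => i; apply/negP => yi.
have visit j : (j <= 4)%N -> exists2 a, odd a = odd j & mark x (a + i).
  move=> j4.
  have [|_ [[a aF <-]]] :=
    xy (NT mshift [set x : marked Z | mark x 0] [set x : marked Z | mark x j])
    _ _ (open_nbhs_nbhs (conj (@open_mark i) yi)).
    exists [set x : marked Z | mark x 0], [set x : marked Z | mark x j].
    by split=> //; apply: (opene_mark (val_at y 0)).
  rewrite /= mark_iter_shift => xa; exists a => //.
  by have := mark_NT_parity aF; rewrite oddD /=; case: (odd a); case: (odd j).
have [a oa xa] := visit 0%N isT; have [b ob xb] := visit 1%N isT.
by have := mark_parity xa xb; rewrite !oddD oa ob; case: (odd i).
Qed.

(** An isolated [x] would be marked at all large times of one parity; two marks in a window of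
    length 3 violate sparsity, as [2 ^ 2 > 3]. *)
Lemma marked_not_isolated x : ~ open [set x].
Proof.
move=> ox.
have ome := opene_mark (val_at x 0) (isT : (0 <= 4)%N).
have [|K [p Kp]] := shift_NT (U := [set x]) _ ome.
  by split=> //; exists x.
have mk n : (K <= n)%N -> odd n = p -> mark x n.
  by move=> Kn np; have [_ [/= ->]] := Kp n Kn np; rewrite mark_iter_shift addn0.
pose n := (K.*2 + p)%N.
have on : odd n = p by rewrite oddD odd_double oddb.
have m0 : mark x n by apply: mk => //; rewrite /n; lia.
have m2 : mark x (n + 2).
  by apply: mk; [rewrite /n; lia|rewrite oddD on addbF].
have := mark_sparse x n 3.
by rewrite !cntS cnt0 addn0 m0 m2; case: (mark x (n + 1)).
Qed.

End marked_dynamics.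

Theorem theorem6p4 (R : realType) (Z : metricType R) :
  compact [set: Z] -> [set: Z] !=set0 ->
  exists (X : metricType R) (T : X -> X),
    [/\ dynamical_system T, transitive_compact T, ~ totally_transitive T &
      [/\
         (exists (f : Z -> X) (g : X -> Z),
            [/\ f @` [set: Z] = [set x | minimal_point T x],
                continuous f, (forall z, g (f z) = z)
              & {within [set x | minimal_point T x], continuous g}]),
        (forall x, minimal_point T x -> T x = x)
      & exists x, [set y | minimal_point T y] = omega_NT T x]].
Proof.
move=> cZ Z0; have [z0 _] := Z0.
exists (marked Z), mshift.
have omegaP x z : (forall W, nbhs (const_point z) W ->
    forall K, exists2 i, (K <= i)%N & W (iter i mshift x)) ->
    omega_NT mshift x (const_point z).
  apply: omega_NT_fixed; [exact: shift_continuous|exact: shift_const_point|].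
  exact: shift_NT.
split.
- split.
  + exact: marked_compact.
  + have [_ [x x0]] := opene_mark z0 (isT : (0 <= 4)%N).
    by exists x, (const_point z0) => xz; rewrite xz in x0.
  + exact: marked_not_isolated.
  + exact: shift_continuous.
  + exact: shift_surjective.
- move=> x; have [z zP] := orbit_cluster_const x cZ.
  by exists (const_point z); exact: omegaP.
(* Going from mark 0 to mark 1 in an even number of steps needs marks at 0 and at an odd
   position. *)
- move=> /(_ 2 isT) /(_ _ _ (opene_mark z0 (isT : (0 <= 4)%N))
    (opene_mark z0 (isT : (1 <= 4)%N)))[n].
  move=> [x [/= x0]].
  rewrite -iterM mark_iter_shift => x1; have := mark_parity x0 x1.
  by rewrite oddD oddM andbF.
- split.
  + exists const_point, (fun x => val_at x 0); split=> //.
    * apply/seteqP; split=> [_ [z _ <-]|x /(minimal_pointP x cZ)[z ->]].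
        exact: minimal_const.
      by exists z.
    * exact: const_point_continuous.
    * by apply: continuous_subspaceT => x; exact: val_at_continuous.
  + by move=> x /(minimal_pointP x cZ)[z ->]; exact: shift_const_point.
  + have [u uP] := compact_dense_seq cZ Z0.
    exists (lacunary_point u); apply/seteqP; split=> [y|y /omega_NT_const[z ->]].
      move=> /(minimal_pointP y cZ)[z ->]; apply: omegaP.
      by apply: lacunary_point_orbit => e K; exact: uP.
    exact: minimal_const.
Qed.
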